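(* (i) The pair $(\leq_{\boldsymbol\Sigma^1_1},\not\subseteq_{\boldsymbol\Sigma^1_1})$ on $\mathfrak T$ is complete for the class $\mathcal C_{\rm qo}$ of analytic quasiorders on standard Borel spaces. (ii) The pair $(\equiv_{\boldsymbol\Sigma^1_1},\mathrm{Disj}_{\boldsymbol\Sigma^1_1})$ on $\mathfrak T$ is complete for the class $\mathcal C_{\rm eq}$ of analytic equivalence relations on standard Borel spaces. Consequently the pair $(\equiv_{\boldsymbol\Sigma^1_1},\neq_{\boldsymbol\Sigma^1_1})$ is also complete for $\mathcal C_{\rm eq}$.
   Context: For finite sequences $s,t\in\omega^{<\omega}$, $s\le t$ means $|s|=|t|$ and $s(i)\le t(i)$ for all $i<|s|$; for $|s|=|t|$, $(s+t)(i)=s(i)+t(i)$. A normal tree on $2\times\omega$ is a set $T$ of pairs $(u,s)\in 2^{<\omega}\times\omega^{<\omega}$ with $|u|=|s|$, containing $(\emptyset,\emptyset)$, closed under taking initial segments (in both coordinates simultaneously), and such that $(u,s)\in T$ and $s\le t$ imply $(u,t)\in T$. $\mathfrak T$ denotes the set of normal trees, a closed (compact Polish) subset of $2^{(2\times\omega)^{<\omega}}$. For $T\in\mathfrak T$, $A(T)=\{\alpha\in 2^\omega:\exists\beta\in\omega^\omega\,\forall n\,(\alpha|_n,\beta|_n)\in T\}$. Relations on $\mathfrak T$: $S\le_{\boldsymbol\Sigma^1_1}T$ iff $\exists\alpha\in\omega^\omega\,\forall(u,s)\,((u,s)\in S\Rightarrow (u,s+\alpha|_{|s|})\in T)$; $S\equiv_{\boldsymbol\Sigma^1_1}T$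 iff $S\le_{\boldsymbol\Sigma^1_1}T$ and $T\le_{\boldsymbol\Sigma^1_1}S$; $S\not\subseteq_{\boldsymbol\Sigma^1_1}T$ iff $A(S)\not\subseteq A(T)$; $S\,\mathrm{Disj}_{\boldsymbol\Sigma^1_1}T$ iff $A(S)\ne\emptyset$, $A(T)\neq\emptyset$ and $A(S)\cap A(T)=\emptyset$; $S\neq_{\boldsymbol\Sigma^1_1}T$ iff $A(S)\ne A(T)$. For pairs $(R_1,R_2)$ of binary relations on a standard Borel space $X$ and $(S_1,S_2)$ on $Y$, a Borel homomorphism is a Borel $f:X\to Y$ with $xR_1y\Rightarrow f(x)S_1f(y)$ and $xR_2y\Rightarrow f(x)S_2f(y)$. A binary relation $R$ is identified with the pair $(R,\neg R)$. For a class $\mathcal C$ of binary relations on standard Borel spaces, a pair $(R_1,R_2)$ is $\mathcal C$-complete if (a) for every $R\in\mathcal C$ there is a Borel homomorphism from $(R,\neg R)$ to $(R_1,R_2)$, and (b) there is some $R\in\mathcal C$ and a Borel homomorphism from $(R_1,R_2)$ to $(R,\neg R)$. *)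

(* Defs.v *)
From Stdlib Require Import Reals List Arith.
Import ListNotations.
Open Scope R_scope.

Definition set (X : Type) := X -> Prop.

Definition is_sigma {X : Type} (S : set (set X)) : Prop :=
  S (fun _ => True) /\
  (forall A, S A -> S (fun x => ~ A x)) /\
  (forall F : nat -> set X, (forall n, S (F n)) -> S (fun x => exists n, F n x)).

Definition gen_sigma {X : Type} (G : set (set X)) : set (set X) :=
  fun A => forall S, is_sigma S -> (forall B, G B -> S B) -> S A.

Definition prod_sigma {X Y : Type} (mX : set (set X)) (mY : set (set Y))
  : set (set (X * Y)) :=
  gen_sigma (fun C => exists A B, mX A /\ mY B /\
                        C = (fun p => A (fst p) /\ B (snd p))).

Definition baire_sigma : set (set (nat -> nat)) :=
  gen_sigma (fun C => exists n k, C = (fun b : nat -> nat => b n = k)).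

Definition is_metric {X : Type} (d : X -> X -> R) : Prop :=
  (forall x y, 0 <= d x y) /\
  (forall x y, d x y = 0 <-> x = y) /\
  (forall x y, d x y = d y x) /\
  (forall x y z, d x z <= d x y + d y z).

Definition metric_complete {X : Type} (d : X -> X -> R) : Prop :=
  forall u : nat -> X,
    (forall eps, 0 < eps -> exists N, forall m n, (N <= m)%nat -> (N <= n)%nat ->
        d (u m) (u n) < eps) ->
    exists x, forall eps, 0 < eps -> exists N, forall n, (N <= n)%nat -> d (u n) x < eps.

Definition metric_separable {X : Type} (d : X -> X -> R) : Prop :=
  (exists e : nat -> X, forall x eps, 0 < eps -> exists n, d x (e n) < eps)
  \/ (X -> False).

Definition metric_open {X : Type} (d : X -> X -> R) (U : set X) : Prop :=
  forall x, U x -> exists eps, 0 < eps /\ forall y, d x y < eps -> U y.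

Definition borel_of_metric {X : Type} (d : X -> X -> R) : set (set X) :=
  gen_sigma (metric_open d).

Definition polish_metric {X : Type} (d : X -> X -> R) : Prop :=
  is_metric d /\ metric_complete d /\ metric_separable d.

Record SBS := {
  sbs_carrier :> Type;
  sbs_meas : set (set sbs_carrier);
  sbs_standard : exists d : sbs_carrier -> sbs_carrier -> R,
      polish_metric d /\ forall A, sbs_meas A <-> borel_of_metric d A
}.

Definition analytic {Y : Type} (mY : set (set Y)) (A : set Y) : Prop :=
  exists B : set (Y * (nat -> nat)),
    prod_sigma mY baire_sigma B /\ forall y, A y <-> exists b, B (y, b).

Definition analytic_rel (X : SBS) (Rel : X -> X -> Prop) : Prop :=
  analytic (prod_sigma (sbs_meas X) (sbs_meas X)) (fun p => Rel (fst p) (snd p)).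

Definition C_qo (X : SBS) (Rel : X -> X -> Prop) : Prop :=
  analytic_rel X Rel /\ (forall x, Rel x x) /\
  (forall x y z, Rel x y -> Rel y z -> Rel x z).

Definition C_eq (X : SBS) (Rel : X -> X -> Prop) : Prop :=
  analytic_rel X Rel /\ (forall x, Rel x x) /\ (forall x y, Rel x y -> Rel y x) /\
  (forall x y z, Rel x y -> Rel y z -> Rel x z).

Definition borel_fun {X Y : Type} (mX : set (set X)) (mY : set (set Y)) (f : X -> Y) : Prop :=
  forall B, mY B -> mX (fun x => B (f x)).

Definition borel_hom {X Y : Type} (mX : set (set X)) (mY : set (set Y))
  (R1 R2 : X -> X -> Prop) (S1 S2 : Y -> Y -> Prop) (f : X -> Y) : Prop :=
  borel_fun mX mY f /\
  (forall x y, R1 x y -> S1 (f x) (f y)) /\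
  (forall x y, R2 x y -> S2 (f x) (f y)).

Definition negrel {X : Type} (Rel : X -> X -> Prop) : X -> X -> Prop :=
  fun x y => ~ Rel x y.

Definition complete_for (C : forall X : SBS, (X -> X -> Prop) -> Prop)
  {Z : Type} (mZ : set (set Z)) (P1 P2 : Z -> Z -> Prop) : Prop :=
  (forall (X : SBS) (Rel : X -> X -> Prop), C X Rel ->
     exists f : X -> Z, borel_hom (sbs_meas X) mZ Rel (negrel Rel) P1 P2 f) /\
  (exists (X : SBS) (Rel : X -> X -> Prop), C X Rel /\
     exists g : Z -> X, borel_hom mZ (sbs_meas X) P1 P2 Rel (negrel Rel) g).

(* A node (u,s) with |u| = |s| is encoded as the list of pairs (u(i), s(i)). *)
Definition node := list (bool * nat).

Definition le_seq (s t : list nat) : Prop :=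
  length s = length t /\ forall i, (i < length s)%nat -> (nth i s 0 <= nth i t 0)%nat.

Definition is_normal_tree (T : node -> bool) : Prop :=
  T [] = true /\
  (forall l k, T l = true -> T (firstn k l) = true) /\
  (forall l t, T l = true -> le_seq (map snd l) t ->
     T (combine (map fst l) t) = true).

Definition NTree := { T : node -> bool | is_normal_tree T }.

(* Borel structure of the closed subspace of 2^((2 x omega)^<omega) *)
Definition NTree_sigma : set (set NTree) :=
  gen_sigma (fun C => exists p : node, C = (fun T : NTree => proj1_sig T p = true)).

Definition prefix (a : nat -> bool) (b : nat -> nat) (n : nat) : node :=
  map (fun i => (a i, b i)) (seq 0 n).

Definition A_of (T : NTree) : set (nat -> bool) :=
  fun a => exists b : nat -> nat, forall n, proj1_sig T (prefix a b n) = true.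

Definition le_S11 (S T : NTree) : Prop :=
  exists al : nat -> nat, forall l : node, proj1_sig S l = true ->
    proj1_sig T (combine (map fst l)
       (map (fun i => nth i (map snd l) 0 + al i)%nat (seq 0 (length l)))) = true.

Definition equiv_S11 (S T : NTree) : Prop := le_S11 S T /\ le_S11 T S.

Definition notsub_S11 (S T : NTree) : Prop := ~ (forall a, A_of S a -> A_of T a).

Definition disj_S11 (S T : NTree) : Prop :=
  (exists a, A_of S a) /\ (exists a, A_of T a) /\ (forall a, ~ (A_of S a /\ A_of T a)).

Definition neq_S11 (S T : NTree) : Prop := ~ (forall a, A_of S a <-> A_of T a).

(* Main.v *)
(** After Louveau and Rosendal.  A standard Borel space is a Borel retract of [2^omega], so an
    analytic quasiorder may be pulled back to an analytic quasiorder [Rel] on [2^omega],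
    the projection of a closed set [Q].  Let [link n a b g] say that, up to length [n],
    [(a, b)] is [(a', b')] for some [(a', b', h)] in [Q] with [h <= g], or else [a = b];
    let [level n a b g] say that [a] and [b] are joined by a chain of [g 0] links.  Levels
    are monotone and subadditive in [g], and by compactness and transitivity of [Rel],
    [Rel a b] holds iff [level n a b g] holds for some [g] and all [n].  The map sending
    [x] to the normal tree of all [(u, s)] with [level |u| u x s] then satisfies
    [A(tree x) = {a | Rel a x}], and a branch [g] witnessing [Rel x y] witnesses
    [tree x <= tree y].  This one map serves all three pairs: for an equivalence relation,
    [A(tree x)] is the class of [x], and distinct classes are disjoint.

    Conversely, [<=] and the equivalence it induces are themselves analytic, and
    [S <= T] forces [A(S)] to be included in [A(T)]. *)

From Stdlib Require Import Bool Reals List Arith Lia Lra Cantor.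
From Stdlib Require Import Classical ClassicalEpsilon.
From Stdlib Require Import FunctionalExtensionality PropExtensionality.
Require Import Defs.
Import ListNotations.
Open Scope nat_scope.

(** * Sigma-algebras *)

Lemma set_ext {X : Type} (A B : set X) : (forall x, A x <-> B x) -> A = B.
Proof.
  intros H; apply functional_extensionality; intros x.
  apply propositional_extensionality, H.
Qed.

Section SigmaAlgebra.
Variables (X : Type) (S : set (set X)).
Hypothesis HS : is_sigma S.

Lemma sigma_ext (A B : set X) : S A -> (forall x, A x <-> B x) -> S B.
Proof. intros HA H; rewrite <- (set_ext A B H); exact HA. Qed.

Lemma sigma_compl (A : set X) : S A -> S (fun x => ~ A x).
Proof. apply HS. Qed.

Lemma sigma_cunion (F : nat -> set X) :
  (forall n, S (F n)) -> S (fun x => exists n, F n x).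
Proof. apply HS. Qed.

Lemma sigma_cinter (F : nat -> set X) :
  (forall n, S (F n)) -> S (fun x => forall n, F n x).
Proof.
  intros H.
  apply sigma_ext with (A := fun x => ~ exists n, ~ F n x).
  - apply sigma_compl, sigma_cunion; intros n; apply sigma_compl, H.
  - intros x; split.
    + intros Hx n; apply NNPP; intros Hn; apply Hx; now exists n.
    + intros Hx [n Hn]; exact (Hn (Hx n)).
Qed.

Lemma sigma_const (P : Prop) : S (fun _ => P).
Proof.
  destruct (classic P) as [H|H].
  - apply sigma_ext with (A := fun _ => True); [apply HS | tauto].
  - apply sigma_ext with (A := fun _ => ~ True);
      [apply sigma_compl, HS | tauto].
Qed.

Lemma sigma_or (A B : set X) : S A -> S B -> S (fun x => A x \/ B x).
Proof.
  intros HA HB.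
  apply sigma_ext with (A := fun x => exists n, match n with 0 => A x | _ => B x end).
  - apply sigma_cunion; intros [|n]; assumption.
  - intros x; split.
    + intros [[|n] H]; tauto.
    + intros [H|H]; [now exists 0 | now exists 1].
Qed.

Lemma sigma_and (A B : set X) : S A -> S B -> S (fun x => A x /\ B x).
Proof.
  intros HA HB.
  apply sigma_ext with (A := fun x => ~ (~ A x \/ ~ B x)).
  - apply sigma_compl, sigma_or; now apply sigma_compl.
  - intros x; split; [intros H; split; apply NNPP |]; tauto.
Qed.

Lemma sigma_imp (A B : set X) : S A -> S B -> S (fun x => A x -> B x).
Proof.
  intros HA HB.
  apply sigma_ext with (A := fun x => ~ A x \/ B x).
  - apply sigma_or; [now apply sigma_compl | assumption].
  - intros x; split; [tauto | intros H; destruct (classic (A x)); tauto].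
Qed.

End SigmaAlgebra.

Lemma gen_sigma_is_sigma {X : Type} (G : set (set X)) : is_sigma (gen_sigma G).
Proof.
  split; [|split].
  - intros S HS _; apply HS.
  - intros A HA S HS HG; apply HS, HA; assumption.
  - intros F HF S HS HG; apply HS; intros n; apply HF; assumption.
Qed.

Lemma gen_sigma_base {X : Type} (G : set (set X)) (A : set X) : G A -> gen_sigma G A.
Proof. intros HA S HS HG; now apply HG. Qed.

(** The sets with measurable preimage form a sigma-algebra, so generators suffice. *)
Lemma borel_fun_gen {X Y : Type} (mX : set (set X)) (G : set (set Y)) (f : X -> Y) :
  is_sigma mX -> (forall B, G B -> mX (fun x => B (f x))) ->
  borel_fun mX (gen_sigma G) f.
Proof.
  intros HX HG B HB.
  apply (HB (fun C => mX (fun x => C (f x)))); [|exact HG].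
  split; [|split].
  - apply HX.
  - intros A HA; now apply HX.
  - intros F HF; apply HX with (F := fun n x => F n (f x)); exact HF.
Qed.

Lemma borel_fun_comp {X Y Z : Type} (mX : set (set X)) (mY : set (set Y))
  (mZ : set (set Z)) (f : X -> Y) (g : Y -> Z) :
  borel_fun mX mY f -> borel_fun mY mZ g -> borel_fun mX mZ (fun x => g (f x)).
Proof. intros Hf Hg B HB; exact (Hf _ (Hg _ HB)). Qed.

Lemma borel_fun_pair {X Y Z : Type} (mX : set (set X)) (mY : set (set Y))
  (mZ : set (set Z)) (f : Z -> X) (g : Z -> Y) :
  is_sigma mZ -> borel_fun mZ mX f -> borel_fun mZ mY g ->
  borel_fun mZ (prod_sigma mX mY) (fun z => (f z, g z)).
Proof.
  intros HZ Hf Hg; apply borel_fun_gen; [exact HZ|].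
  intros C (A & B & HA & HB & ->); simpl.
  apply (sigma_and _ _ HZ); [now apply Hf | now apply Hg].
Qed.

Lemma borel_fun_fst {X Y : Type} (mX : set (set X)) (mY : set (set Y)) :
  is_sigma mY -> borel_fun (prod_sigma mX mY) mX fst.
Proof.
  intros HY A HA; apply gen_sigma_base.
  exists A, (fun _ => True); repeat split; [exact HA | apply HY |].
  apply set_ext; tauto.
Qed.

Lemma borel_fun_snd {X Y : Type} (mX : set (set X)) (mY : set (set Y)) :
  is_sigma mX -> borel_fun (prod_sigma mX mY) mY snd.
Proof.
  intros HX B HB; apply gen_sigma_base.
  exists (fun _ => True), B; repeat split; [apply HX | exact HB |].
  apply set_ext; tauto.
Qed.

(** * Sequences and compactness *)

Definition agree {A : Type} (n : nat) (a b : nat -> A) : Prop :=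
  forall i, i < n -> a i = b i.

Lemma agree_refl {A : Type} n (a : nat -> A) : agree n a a.
Proof. now intros i _. Qed.

Lemma agree_sym {A : Type} n (a b : nat -> A) : agree n a b -> agree n b a.
Proof. intros H i Hi; symmetry; now apply H. Qed.

Lemma agree_trans {A : Type} n (a b c : nat -> A) :
  agree n a b -> agree n b c -> agree n a c.
Proof. intros H K i Hi; rewrite H by exact Hi; now apply K. Qed.

Lemma agree_le {A : Type} m n (a b : nat -> A) : m <= n -> agree n a b -> agree m a b.
Proof. intros Hmn H i Hi; apply H; lia. Qed.

Definition update {A : Type} (a : nat -> A) (n : nat) (v : A) : nat -> A :=
  fun i => if Nat.eq_dec i n then v else a i.

Lemma update_id {A : Type} (a : nat -> A) n v : a n = v -> update a n v = a.
Proof.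
  intros H; apply functional_extensionality; intros i; unfold update.
  destruct (Nat.eq_dec i n); congruence.
Qed.

(** Induction on the size of the support: the space splits into countably many measurable pieces by
    the value of the last coordinate, and on each piece that value is frozen by [update]. *)
Lemma sigma_finite_support {X A : Type} (S : set (set X)) (c : X -> nat -> A)
  (en : nat -> A) (n : nat) (P : (nat -> A) -> Prop) :
  is_sigma S -> (forall v, exists k, en k = v) ->
  (forall i v, S (fun x => c x i = v)) ->
  (forall a b, agree n a b -> P a -> P b) -> S (fun x => P (c x)).
Proof.
  intros HS Hen Hc; revert P; induction n as [|n IH]; intros P HP.
  - apply (sigma_ext _ S) with (A := fun _ => exists a, P a).
    + now apply sigma_const.
    + intros x; split; [|now exists (c x)].
      intros [a Ha]; apply (HP a); [intros i Hi; lia | exact Ha].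
  - apply (sigma_ext _ S)
      with (A := fun x => exists k, c x n = en k /\ P (update (c x) n (en k))).
    + apply sigma_cunion; [exact HS|]; intros k.
      apply sigma_and; [exact HS | apply Hc |].
      apply (IH (fun a => P (update a n (en k)))).
      intros a b Hab; apply HP; intros i Hi; unfold update.
      destruct (Nat.eq_dec i n); [reflexivity | apply Hab; lia].
    + intros x; split.
      * intros (k & Hk & H); now rewrite update_id in H.
      * intros H; destruct (Hen (c x n)) as [k Hk]; exists k.
        rewrite update_id by congruence; now split.
Qed.

(** [P n g] may depend on all of [g], so the limit [h] itself need not satisfy [P]; it is only
    approximated by sequences that do. *)
Lemma konig {A : Type} (L : nat -> list A) (P : nat -> (nat -> A) -> Prop) :
  (forall m n g, m <= n -> P n g -> P m g) ->
  (forall n, exists g, (forall i, i < n -> In (g i) (L i)) /\ P n g) ->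
  exists h, (forall i, In (h i) (L i)) /\
    forall m, exists g, agree m h g /\ P m g.
Proof.
  intros Hmon Hex.
  (* [ext m h]: the first [m] values of [h] extend to witnesses of every length [n]. *)
  pose (ext := fun m (h : nat -> A) => forall n, exists g,
    agree m h g /\ (forall i, i < n -> In (g i) (L i)) /\ P n g).
  assert (Hstep : forall m h, exists v,
            ext m h -> ext (S m) (update h m v) /\ In v (L m)).
  { intros m h; destruct (classic (ext m h)) as [Hm|Hm].
    2: { destruct (Hex 0) as [g _]; exists (g 0); tauto. }
    assert (Hv : exists v, In v (L m) /\ ext (S m) (update h m v)).
    { apply NNPP; intros Hno.
      (* If every candidate value fails, each at its own length, then finiteness of [L m] gives one
         length [N] at which all fail. *)
      assert (HN : exists N, forall v, In v (L m) -> forall g,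
                agree (S m) (update h m v) g ->
                (forall i, i < N -> In (g i) (L i)) -> ~ P N g).
      { assert (Hno' : forall v, In v (L m) -> ~ ext (S m) (update h m v))
          by (intros v Hv He; apply Hno; eauto).
        clear Hno Hm; induction (L m) as [|w l IH] in Hno' |- *.
        - exists 0; intros v [].
        - destruct IH as [N1 HN1]; [intros v Hv; apply Hno'; now right|].
          assert (Hw := Hno' w (or_introl eq_refl)).
          apply not_all_ex_not in Hw; destruct Hw as [N2 HN2].
          exists (N1 + N2); intros v [<-|Hv] g Hg HgL HP.
          + apply HN2; exists g; split; [exact Hg|]; split.
            * intros i Hi; apply HgL; lia.
            * apply (Hmon _ (N1 + N2)); [lia | exact HP].
          + apply (HN1 v Hv g Hg).
            * intros i Hi; apply HgL; lia.
            * apply (Hmon _ (N1 + N2)); [lia | exact HP]. }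
      destruct HN as [N HN].
      (* This length exceeds [m], so that [g m] lies in [L m], and is at least [N]. *)
      destruct (Hm (S m + N)) as (g & Hg & HgL & HP).
      apply (HN (g m)) with g.
      - apply HgL; lia.
      - intros i Hi; unfold update; destruct (Nat.eq_dec i m); [congruence|].
        apply Hg; lia.
      - intros i Hi; apply HgL; lia.
      - apply (Hmon _ (S m + N)); [lia | exact HP]. }
    destruct Hv as (v & Hv & He); exists v; tauto. }
  destruct (choice (fun p v => ext (fst p) (snd p) ->
              ext (S (fst p)) (update (snd p) (fst p) v) /\ In v (L (fst p))))
    as [next Hnext]; [intros [m h]; apply Hstep|].
  destruct (Hex 0) as [g0 _].
  pose (seq := fix seq m := match m with
                 | 0 => g0
                 | S m => update (seq m) m (next (m, seq m)) end).
  assert (Hseq : forall m, ext m (seq m)).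
  { induction m as [|m IH].
    - intros n; destruct (Hex n) as (g & Hg); exists g; split; [|exact Hg].
      intros i Hi; lia.
    - exact (proj1 (Hnext (m, seq m) IH)). }
  assert (Hst : forall m k, agree m (seq m) (seq (m + k))).
  { intros m k; induction k as [|k IH].
    - rewrite Nat.add_0_r; apply agree_refl.
    - rewrite Nat.add_succ_r; intros i Hi; rewrite IH by exact Hi; simpl.
      unfold update; destruct (Nat.eq_dec i (m + k)); [lia | reflexivity]. }
  exists (fun i => seq (S i) i); split.
  - intros i; simpl; unfold update at 1.
    destruct (Nat.eq_dec i i) as [_|n]; [|now destruct n].
    exact (proj2 (Hnext (i, seq i) (Hseq i))).
  - intros m; destruct (Hseq m m) as (g & Hg & _ & HP); exists g; split; [|exact HP].
    intros i Hi; rewrite <- Hg by exact Hi.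
    replace m with (S i + (m - S i)) by lia; apply Hst; lia.
Qed.

Lemma konig_bool (P : nat -> (nat -> bool) -> Prop) :
  (forall m n g, m <= n -> P n g -> P m g) ->
  (forall n g h, agree n g h -> P n g -> P n h) ->
  (forall n, exists g, P n g) -> exists h, forall n, P n h.
Proof.
  intros Hmon Hloc Hex.
  destruct (konig (fun _ => [true; false]) P) as (h & _ & Hh).
  - exact Hmon.
  - intros n; destruct (Hex n) as [g Hg]; exists g; split; [|exact Hg].
    intros i _; destruct (g i); simpl; tauto.
  - exists h; intros n; destruct (Hh n) as (g & Hg & HP).
    now apply (Hloc n g); [apply agree_sym|].
Qed.

(** * Suslin sets *)

Section Suslin.
Variables (Z : Type) (agr : nat -> Z -> Z -> Prop).
Hypothesis agr_le : forall m n z z', m <= n -> agr n z z' -> agr m z z'.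

Definition closed_rel (Q : Z -> (nat -> nat) -> Prop) : Prop :=
  forall z g, ~ Q z g ->
    exists n, forall z' g', agr n z z' -> agree n g g' -> ~ Q z' g'.

Definition suslin (P : set Z) : Prop :=
  exists Q, closed_rel Q /\ forall z, P z <-> exists g, Q z g.

(** Carrying the complement along makes the class closed under complements by definition; it then
    contains every Borel set, which is how Borel sets are seen to be Suslin. *)
Definition bisuslin (P : set Z) : Prop := suslin P /\ suslin (fun z => ~ P z).

Lemma suslin_ext (P P' : set Z) : suslin P -> (forall z, P z <-> P' z) -> suslin P'.
Proof. intros H HP; now rewrite <- (set_ext _ _ HP). Qed.

Lemma suslin_clopen (P : set Z) n :
  (forall z z', agr n z z' -> P z' -> P z) -> suslin P.
Proof.
  intros H; exists (fun z _ => P z); split.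
  - intros z g Hz; exists n; intros z' g' Hzz _ Hz'; apply Hz; exact (H z z' Hzz Hz').
  - intros z; split; [now exists (fun _ => 0) | now intros []].
Qed.

(** The first value of the witness selects a member of the union; the rest is a witness for that
    member. *)
Lemma suslin_cunion (F : nat -> set Z) :
  (forall n, suslin (F n)) -> suslin (fun z => exists n, F n z).
Proof.
  intros H; destruct (choice _ H) as [Q HQ].
  exists (fun z g => Q (g 0) z (fun i => g (S i))); split.
  - intros z g Hz.
    destruct (proj1 (HQ (g 0)) z _ Hz) as [n Hn]; exists (S n).
    intros z' g' Hzz Hg; rewrite <- Hg by lia; apply Hn.
    + apply agr_le with (2 := Hzz); lia.
    + intros i Hi; apply Hg; lia.
  - intros z; split.
    + intros [n Hn]; apply (HQ n) in Hn; destruct Hn as [g Hg].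
      now exists (fun i => match i with 0 => n | S i => g i end).
    + intros [g Hg]; exists (g 0); apply HQ; eauto.
Qed.

(** One sequence carries a witness for each [m] in its row of indices [to_nat (m, i)]. *)
Lemma suslin_cinter (F : nat -> set Z) :
  (forall n, suslin (F n)) -> suslin (fun z => forall n, F n z).
Proof.
  intros H; destruct (choice _ H) as [Q HQ].
  exists (fun z g => forall m, Q m z (fun i => g (to_nat (m, i)))); split.
  - intros z g Hz; apply not_all_ex_not in Hz; destruct Hz as [m Hm].
    destruct (proj1 (HQ m) z _ Hm) as [n Hn].
    (* Failure in row [m] shows in its first [n] entries, which all sit below some [N]. *)
    assert (HN : exists N, n <= N /\ forall i, i < n -> to_nat (m, i) < N).
    { clear; induction n as [|n [N [HN1 HN2]]]; [exists 0; split; intros; lia|].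
      exists (S (N + to_nat (m, n))); split; [lia|].
      intros i Hi; destruct (Nat.eq_dec i n) as [->|]; [lia|].
      enough (to_nat (m, i) < N) by lia; apply HN2; lia. }
    destruct HN as (N & HN1 & HN2); exists N; intros z' g' Hzz Hg HQ'.
    apply (Hn z' (fun i => g' (to_nat (m, i)))).
    + now apply agr_le with N.
    + intros i Hi; apply Hg, HN2, Hi.
    + apply HQ'.
  - intros z; split.
    + intros Hz.
      assert (Hg : forall n, exists g, Q n z g) by (intros n; apply HQ, Hz).
      destruct (choice _ Hg) as [G HG].
      exists (fun j => G (fst (of_nat j)) (snd (of_nat j))); intros m.
      replace (fun i => _) with (G m); [apply HG|].
      apply functional_extensionality; intros i; now rewrite cancel_of_to.
    + intros [g Hg] n; apply HQ; eauto.
Qed.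

Lemma bisuslin_sigma : is_sigma bisuslin.
Proof.
  split; [|split].
  - split; apply suslin_clopen with 0; tauto.
  - intros A [H1 H2]; split; [exact H2|].
    apply (suslin_ext A); [exact H1|]; intros z; split; [tauto | apply NNPP].
  - intros F HF; split.
    + apply suslin_cunion; intros n; apply HF.
    + apply suslin_ext with (P := fun z => forall n, ~ F n z).
      * apply suslin_cinter; intros n; apply HF.
      * intros z; split; [intros H [n Hn]; exact (H n Hn) | eauto].
Qed.

Lemma bisuslin_clopen (P : set Z) n :
  (forall z z', agr n z z' -> (P z <-> P z')) -> bisuslin P.
Proof.
  intros H; split; apply suslin_clopen with n; intros z z' Hz;
    specialize (H z z' Hz); tauto.
Qed.

End Suslin.

(** * The normal tree of an analytic quasiorder on Cantor space *)

Definition agree_pair {A B : Type} (n : nat) (z z' : (nat -> A) * (nat -> B)) : Prop :=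
  agree n (fst z) (fst z') /\ agree n (snd z) (snd z').

Lemma agree_pair_le {A B : Type} m n (z z' : (nat -> A) * (nat -> B)) :
  m <= n -> agree_pair n z z' -> agree_pair m z z'.
Proof. intros Hmn [H1 H2]; split; eapply agree_le; eauto. Qed.

Lemma nth_map_seq {A : Type} (f : nat -> A) n i d :
  i < n -> nth i (map f (seq 0 n)) d = f i.
Proof.
  intros Hi; rewrite nth_indep with (d' := f 0) by now rewrite length_map, length_seq.
  now rewrite map_nth, seq_nth.
Qed.

(** The two coordinates of a node are made total by the defaults [false] and 0, so that nodes and
    branches are compared by the same relation [agree]. *)
Definition node_u (l : node) : nat -> bool := fun i => fst (nth i l (false, 0)).
Definition node_s (l : node) : nat -> nat := fun i => snd (nth i l (false, 0)).

Lemma length_combine_fst (l : node) (t : list nat) :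
  length t = length l -> length (combine (map fst l) t) = length l.
Proof. intros H; rewrite length_combine, length_map; lia. Qed.

Lemma node_combine (l : node) (t : list nat) i :
  length t = length l ->
  node_u (combine (map fst l) t) i = node_u l i /\
  node_s (combine (map fst l) t) i = nth i t 0.
Proof.
  intros H; unfold node_u, node_s.
  rewrite combine_nth by now rewrite length_map.
  split; [exact (map_nth fst l (false, 0) i) | reflexivity].
Qed.

Lemma nth_map_snd (l : node) i : nth i (map snd l) 0 = node_s l i.
Proof. exact (map_nth snd l (false, 0) i). Qed.

Lemma node_prefix a b n :
  length (prefix a b n) = n /\ agree n (node_u (prefix a b n)) a /\
  agree n (node_s (prefix a b n)) b.
Proof.
  unfold prefix, node_u, node_s; rewrite length_map, length_seq.
  repeat split; intros i Hi; now rewrite nth_map_seq.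
Qed.

Section Tree.
Variables (Rel : (nat -> bool) -> (nat -> bool) -> Prop)
  (Q : (nat -> bool) * (nat -> bool) -> (nat -> nat) -> Prop).
Hypothesis Rel_refl : forall a, Rel a a.
Hypothesis Rel_trans : forall a b c, Rel a b -> Rel b c -> Rel a c.
Hypothesis Q_closed : closed_rel _ agree_pair Q.
Hypothesis Q_Rel : forall a b, Rel a b <-> exists g, Q (a, b) g.

(** Taking [h] below [g] makes links upward closed in [g], as normality demands, and leaves finitely
    many values per coordinate, as compactness demands. The alternative [agree n a b] allows chains
    to be padded. *)
Definition link (n : nat) (a b : nat -> bool) (g : nat -> nat) : Prop :=
  agree n a b \/
  exists a' b' h, agree n a a' /\ agree n b b' /\ (forall i, i < n -> h i <= g i) /\
    Q (a', b') h.

Fixpoint chain (k n : nat) (a b : nat -> bool) (g : nat -> nat) : Prop :=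
  match k with
  | 0 => agree n a b
  | S k => exists c, chain k n a c g /\ link n c b g
  end.

(* Bounding the length of the chains by [g 0] makes levels additive in [g], while keeping
   the branches inside [Rel]. *)
Definition level (n : nat) (a b : nat -> bool) (g : nat -> nat) : Prop :=
  chain (g 0) n a b g.

(** Shortening, moving the ends beyond the length and raising [g] are treated together here and in
    the analogues for chains and levels. *)
Lemma link_local n m a a' b b' g g' :
  m <= n -> agree m a a' -> agree m b b' -> (forall i, i < m -> g i <= g' i) ->
  link n a b g -> link m a' b' g'.
Proof.
  intros Hmn Ha Hb Hg [H|(a1 & b1 & h & H1 & H2 & H3 & H4)].
  - left; apply agree_trans with a; [now apply agree_sym|].
    apply agree_trans with b; [now apply agree_le with n | exact Hb].
  - right; exists a1, b1, h; repeat split; [| | |exact H4].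
    + apply agree_trans with a; [now apply agree_sym | now apply agree_le with n].
    + apply agree_trans with b; [now apply agree_sym | now apply agree_le with n].
    + intros i Hi; rewrite H3 by lia; now apply Hg.
Qed.

Lemma chain_local k n m a a' b b' g g' :
  m <= n -> agree m a a' -> agree m b b' -> (forall i, i < m -> g i <= g' i) ->
  chain k n a b g -> chain k m a' b' g'.
Proof.
  intros Hmn Ha Hb Hg; revert b b' Hb; induction k as [|k IH]; intros b b' Hb; simpl.
  - intros H; apply agree_trans with a; [now apply agree_sym|].
    apply agree_trans with b; [now apply agree_le with n | exact Hb].
  - intros (c & H1 & H2); exists c; split.
    + now apply (IH c c); [apply agree_refl|].
    + now apply (link_local n m c c b b' g g'); [| apply agree_refl | | |].
Qed.

Lemma chain_length_le k k' n a b g : k <= k' -> chain k n a b g -> chain k' n a b g.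
Proof.
  induction 1 as [|k' _ IH]; [tauto|].
  intros H; exists b; split; [now apply IH | left; apply agree_refl].
Qed.

Lemma chain_app k j n a b c g :
  chain k n a b g -> chain j n b c g -> chain (k + j) n a c g.
Proof.
  intros H; revert c; induction j as [|j IH]; intros c; simpl.
  - intros Hc; rewrite Nat.add_0_r.
    now apply (chain_local k n n a a b c g g); [| apply agree_refl | | |].
  - intros (c' & H1 & H2); rewrite Nat.add_succ_r; exists c'; split; auto.
Qed.

(** At length 0 all sequences agree, so the number [g 0] of permitted links is immaterial. *)
Lemma level_zero a b g : level 0 a b g.
Proof.
  apply chain_length_le with 0; [lia|]; intros i Hi; lia.
Qed.

Lemma level_local n m a a' b b' g g' :
  m <= n -> agree m a a' -> agree m b b' -> (forall i, i < m -> g i <= g' i) ->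
  level n a b g -> level m a' b' g'.
Proof.
  (* Only for positive [m] do the hypotheses compare [g 0] with [g' 0]. *)
  intros Hmn Ha Hb Hg H; destruct m as [|m]; [apply level_zero|].
  apply chain_length_le with (g 0); [apply Hg; lia|].
  now apply (chain_local _ n (S m) a a' b b' g g').
Qed.

(** The concatenated chain has [g 0 + h 0] links, exactly what the sum permits, and each half
    survives raising its bound to the sum. *)
Lemma level_add n a b c g h :
  level n a b g -> level n b c h -> level n a c (fun i => g i + h i).
Proof.
  intros H1 H2; apply chain_app with b.
  - apply (chain_local _ n n a a b b g); auto using agree_refl; intros; lia.
  - apply (chain_local _ n n b b c c h); auto using agree_refl; intros; lia.
Qed.

(** If [a] and [b] differ, long links come from elements of [Q] whose witnesses are bounded by [g];
    a limit [h] of these exists by compactness, and closedness puts [((a, b), h)] into [Q]. *)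
Lemma link_limit a b g : (forall n, link n a b g) -> Rel a b.
Proof.
  intros H; destruct (classic (a = b)) as [<-|Hab]; [apply Rel_refl|].
  assert (Hd : exists d, a d <> b d).
  { apply not_all_ex_not; intros He; apply Hab, functional_extensionality, He. }
  destruct Hd as [d Hd].
  destruct (konig (fun i => seq 0 (S (g i)))
    (fun n h => exists a' b', agree n a a' /\ agree n b b' /\ Q (a', b') h))
    as (h & _ & Hh).
  - intros m n h Hmn (a' & b' & H1 & H2 & H3); exists a', b'.
    repeat split; [now apply agree_le with n | now apply agree_le with n | exact H3].
  (* A length beyond the difference [d] rules out the first alternative of [link]. *)
  - intros n; destruct (H (n + S d)) as [Hn|(a' & b' & h & H1 & H2 & H3 & H4)].
    + exfalso; apply Hd, Hn; lia.
    + exists h; split.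
      * intros i Hi; apply in_seq; assert (h i <= g i) by (apply H3; lia); lia.
      * exists a', b'; repeat split; [| | exact H4];
          apply agree_le with (n + S d); (lia || assumption).
  - apply Q_Rel; exists h; apply NNPP; intros HQ.
    destruct (Q_closed _ _ HQ) as [n Hn].
    destruct (Hh n) as (h' & Hhh & a' & b' & H1 & H2 & H3).
    now apply (Hn (a', b') h').
Qed.

(** The intermediate points may vary with [n]. As [k] is fixed, compactness of Cantor space gives a
    last intermediate point [c] that serves all [n], and induction applies up to [c]. *)
Lemma chain_limit k a b g : (forall n, chain k n a b g) -> Rel a b.
Proof.
  revert b; induction k as [|k IH]; intros b H.
  - replace b with a; [apply Rel_refl|].
    apply functional_extensionality; intros i; apply (H (S i)); lia.
  - destruct (konig_bool (fun n c => chain k n a c g /\ link n c b g))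
      as [c Hc].
    + intros m n c Hmn [H1 H2]; split.
      * apply (chain_local k n m a a c c g g); auto using agree_refl.
      * apply (link_local n m c c b b g g); auto using agree_refl.
    + intros n c c' Hcc [H1 H2]; split.
      * apply (chain_local k n n a a c c' g g); auto using agree_refl.
      * apply (link_local n n c c' b b g g); auto using agree_refl.
    + intros n; apply H.
    + apply Rel_trans with c.
      * apply IH; intros n; apply Hc.
      * apply link_limit with g; intros n; apply Hc.
Qed.

Lemma level_branch a b : Rel a b <-> exists g, forall n, level n a b g.
Proof.
  split.
  - intros H; apply Q_Rel in H; destruct H as [g Hg].
    (* The successor makes the value at 0 positive, so that one link is permitted. *)
    exists (fun i => S (g i)); intros n.
    apply chain_length_le with 1; [lia|].
    exists a; split; [apply agree_refl|].
    right; exists a, b, g; repeat split; auto using agree_refl.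
  - intros [g Hg]; exact (chain_limit (g 0) a b g Hg).
Qed.

Definition tree_fun (x : nat -> bool) (l : node) : bool :=
  if excluded_middle_informative (level (length l) (node_u l) x (node_s l))
  then true else false.

Lemma tree_funP x l :
  tree_fun x l = true <-> level (length l) (node_u l) x (node_s l).
Proof.
  unfold tree_fun; destruct (excluded_middle_informative _); split;
    (tauto || discriminate).
Qed.

Lemma tree_fun_normal x : is_normal_tree (tree_fun x).
Proof.
  split; [|split].
  - apply tree_funP, level_zero.
  - intros l k H; apply tree_funP; apply tree_funP in H; revert H.
    rewrite length_firstn.
    apply level_local; [lia | | apply agree_refl |]; unfold node_u, node_s.
    + intros i Hi; rewrite nth_firstn.
      now rewrite (proj2 (Nat.ltb_lt i k)) by lia.
    + intros i Hi; rewrite nth_firstn.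
      now rewrite (proj2 (Nat.ltb_lt i k)) by lia.
  - intros l t H [Hlen Hle]; rewrite length_map in Hlen, Hle.
    apply tree_funP; apply tree_funP in H; revert H.
    rewrite length_combine_fst by easy.
    apply level_local; [lia | | apply agree_refl |]; intros i Hi;
      destruct (node_combine l t i) as [H1 H2]; try easy.
    rewrite H2, <- nth_map_snd; now apply Hle.
Qed.

Definition tree (x : nat -> bool) : NTree := exist _ (tree_fun x) (tree_fun_normal x).

Lemma A_of_tree x a : A_of (tree x) a <-> Rel a x.
Proof.
  rewrite level_branch; unfold A_of; simpl.
  split; intros [g Hg]; exists g; intros n; specialize (Hg n);
    destruct (node_prefix a g n) as (H1 & H2 & H3).
  - apply tree_funP in Hg; revert Hg; rewrite H1.
    apply level_local; auto using agree_refl.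
    intros i Hi; now rewrite H3.
  - apply tree_funP; revert Hg; rewrite H1.
    apply level_local; auto using agree_refl, agree_sym.
    intros i Hi; now rewrite H3.
Qed.

(** A branch [g] for [Rel x y] is the shift: by [level_add], a level from [u] to [x] with bound [s]
    and one from [x] to [y] with bound [g] give one from [u] to [y] with bound [s + g]. *)
Lemma le_S11_tree x y : Rel x y -> le_S11 (tree x) (tree y).
Proof.
  intros H; apply level_branch in H; destruct H as [g Hg].
  exists g; intros l Hl; simpl in *; apply tree_funP in Hl; apply tree_funP.
  rewrite length_combine_fst by now rewrite length_map, length_seq.
  refine (level_local _ _ _ _ _ _ _ _ (le_n _) _ (agree_refl _ _) _
            (level_add _ _ _ _ _ _ Hl (Hg (length l)))).
  - intros i Hi; symmetry; apply node_combine; now rewrite length_map, length_seq.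
  - intros i Hi.
    rewrite (proj2 (node_combine l _ i ltac:(now rewrite length_map, length_seq))).
    now rewrite nth_map_seq, nth_map_snd.
Qed.

(** Finite dependence on [x] is what makes the map [tree] Borel. *)
Lemma tree_fun_local l x y :
  agree (length l) x y -> tree_fun x l = true -> tree_fun y l = true.
Proof.
  intros Hxy H; apply tree_funP; apply tree_funP in H; revert H.
  apply level_local; auto using agree_refl.
Qed.

End Tree.

Definition cantor_sigma : set (set (nat -> bool)) :=
  gen_sigma (fun C => exists n, C = (fun a => a n = true)).

Lemma bool_coord_sigma {X : Type} (S : set (set X)) (c : X -> bool) v :
  is_sigma S -> S (fun x => c x = true) -> S (fun x => c x = v).
Proof.
  intros HS H; destruct v; [exact H|].
  apply (sigma_ext _ S) with (A := fun x => c x <> true);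
    [now apply sigma_compl | intros x; apply not_true_iff_false].
Qed.

Lemma bool_enum (v : bool) : exists k, Nat.odd k = v.
Proof. destruct v; [now exists 1 | now exists 0]. Qed.

(** * Standard Borel spaces as Borel retracts of Cantor space *)

Definition rad (n : nat) : R := (/ INR (S n))%R.

Lemma rad_pos n : (0 < rad n)%R.
Proof. apply Rinv_0_lt_compat, lt_0_INR; lia. Qed.

Lemma rad_le m n : m <= n -> (rad n <= rad m)%R.
Proof.
  intros H; apply Rinv_le_contravar; [apply lt_0_INR; lia | apply le_INR; lia].
Qed.

Lemma rad_small eps : (0 < eps)%R -> exists n, (rad n < eps)%R.
Proof.
  intros H; destruct (archimed_cor1 eps H) as ([|n] & H1 & H2); [lia|].
  now exists n.
Qed.

Section Retract.
Variables (X : Type) (d : X -> X -> R) (e : nat -> X).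
Hypothesis d_metric : is_metric d.
Hypothesis d_complete : metric_complete d.
Hypothesis e_dense : forall x eps, (0 < eps)%R -> exists n, (d x (e n) < eps)%R.

Local Notation mem a n i := (a (to_nat (n, i)) = true).

(** A point is coded by the balls around the dense points [e i] that contain it, with radii
    [rad n]. *)
Definition code_point (x : X) (m : nat) : bool :=
  if Rlt_dec (d x (e (snd (of_nat m)))) (rad (fst (of_nat m))) then true else false.

Lemma code_point_mem x n i : mem (code_point x) n i <-> (d x (e i) < rad n)%R.
Proof.
  unfold code_point; rewrite cancel_of_to; simpl.
  destruct (Rlt_dec _ _); split; (tauto || discriminate).
Qed.

(** Countably many conditions on bits, hence Borel. They make the centres of listed balls, one for
    each radius, a Cauchy sequence. *)
Definition coherent (a : nat -> bool) : Prop :=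
  (forall n, exists i, mem a n i) /\
  (forall n i m j, mem a n i -> mem a m j -> (d (e i) (e j) <= rad n + rad m)%R).

(** The inequality is weak because strict ones are lost in the limit. *)
Definition limit_of (a : nat -> bool) (x : X) : Prop :=
  forall n i, mem a n i -> (d x (e i) <= rad n)%R.

Lemma Rle_rad_eps u v : (forall n, u <= v + 2 * rad n)%R -> (u <= v)%R.
Proof.
  intros H; apply le_epsilon; intros eps Heps.
  destruct (rad_small (eps / 2)) as [n Hn]; [lra|].
  specialize (H n); lra.
Qed.

Lemma limit_of_unique a x y : coherent a -> limit_of a x -> limit_of a y -> x = y.
Proof.
  destruct d_metric as (D0 & D1 & D2 & D3).
  intros [Ha _] Hx Hy; apply D1, Rle_antisym; [|apply D0].
  apply Rle_rad_eps; intros n; destruct (Ha n) as [i Hi].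
  specialize (D3 x (e i) y); specialize (Hx n i Hi); specialize (Hy n i Hi).
  rewrite D2 in Hy; lra.
Qed.

Lemma limit_of_exists a : coherent a -> exists x, limit_of a x.
Proof.
  destruct d_metric as (D0 & D1 & D2 & D3).
  intros [Ha Hd]; destruct (choice _ Ha) as [k Hk].
  destruct (d_complete (fun n => e (k n))) as [x Hx].
  - intros eps Heps; destruct (rad_small (eps / 2)) as [N HN]; [lra|].
    exists N; intros m n Hm Hn; cbv beta.
    assert (H := Hd _ _ _ _ (Hk m) (Hk n)).
    assert (H1 := rad_le _ _ Hm); assert (H2 := rad_le _ _ Hn); lra.
  - exists x; intros n i Hi; apply Rle_rad_eps; intros m.
    destruct (Hx (rad m) (rad_pos m)) as [N HN].
    (* At index [N + m] the centre is within [rad m] of [x] and its ball has radius at most [rad m]: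
       together the error [2 * rad m]. *)
    specialize (HN (N + m) ltac:(lia)); cbv beta in HN.
    assert (H := Hd _ _ _ _ (Hk (N + m)) Hi).
    assert (H1 := rad_le m (N + m) ltac:(lia)).
    specialize (D3 x (e (k (N + m))) (e i)).
    rewrite (D2 x (e (k (N + m)))) in D3; lra.
Qed.

Lemma code_point_coherent x : coherent (code_point x).
Proof.
  destruct d_metric as (D0 & D1 & D2 & D3); split.
  - intros n; destruct (e_dense x (rad n) (rad_pos n)) as [i Hi].
    exists i; now apply code_point_mem.
  - intros n i m j Hi Hj; apply code_point_mem in Hi, Hj.
    specialize (D3 (e i) x (e j)); rewrite (D2 (e i) x) in D3; lra.
Qed.

Lemma code_point_limit x : limit_of (code_point x) x.
Proof. intros n i Hi; apply code_point_mem in Hi; lra. Qed.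

(** Incoherent sequences go to the default [e 0], which keeps the map total and Borel. *)
Definition decode_point (a : nat -> bool) : X :=
  epsilon (inhabits (e 0)) (fun x =>
    (coherent a -> limit_of a x) /\ (~ coherent a -> x = e 0)).

Lemma decode_point_spec a :
  (coherent a -> limit_of a (decode_point a)) /\
  (~ coherent a -> decode_point a = e 0).
Proof.
  unfold decode_point; apply epsilon_spec.
  destruct (classic (coherent a)) as [H|H].
  - destruct (limit_of_exists a H) as [x Hx]; exists x; tauto.
  - exists (e 0); tauto.
Qed.

Lemma decode_code_point x : decode_point (code_point x) = x.
Proof.
  apply (limit_of_unique (code_point x)).
  - apply code_point_coherent.
  - apply decode_point_spec, code_point_coherent.
  - apply code_point_limit.
Qed.

Lemma ball_open x r : metric_open d (fun y => (d y x < r)%R).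
Proof.
  destruct d_metric as (D0 & D1 & D2 & D3).
  intros y Hy; exists (r - d y x)%R; split; [lra|].
  intros z Hz; specialize (D3 z y x); rewrite (D2 z y) in D3; lra.
Qed.

Lemma code_point_borel : borel_fun (borel_of_metric d) cantor_sigma code_point.
Proof.
  apply borel_fun_gen; [apply gen_sigma_is_sigma|].
  intros C [m ->]; apply gen_sigma_base.
  intros x Hx.
  destruct (ball_open (e (snd (of_nat m))) (rad (fst (of_nat m))) x) as (r & Hr & H).
  - revert Hx; unfold code_point; now destruct (Rlt_dec _ _).
  - exists r; split; [exact Hr|]; intros y Hy; specialize (H y Hy).
    unfold code_point; now destruct (Rlt_dec _ _).
Qed.

(** A listed ball of radius less than half the room around the point lies inside [U]. The right-hand
    side is a countable union of bit conditions, since its clause on [y] does not involve [a]. *)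
Lemma decode_point_open U a : metric_open d U -> coherent a ->
  (U (decode_point a) <->
   exists n i, mem a n i /\ forall y, (d y (e i) <= rad n)%R -> U y).
Proof.
  destruct d_metric as (D0 & D1 & D2 & D3).
  intros HU Ha; assert (Hl := proj1 (decode_point_spec a) Ha); split.
  - intros H; destruct (HU _ H) as (r & Hr & HUr).
    destruct (rad_small (r / 2)) as [n Hn]; [lra|].
    destruct (proj1 Ha n) as [i Hi]; exists n, i; split; [exact Hi|].
    intros y Hy; apply HUr.
    specialize (Hl n i Hi); specialize (D3 (decode_point a) (e i) y).
    rewrite (D2 y) in Hy; lra.
  - intros (n & i & Hi & H); apply H, Hl, Hi.
Qed.

Lemma cantor_sigma_coord m : cantor_sigma (fun a => a m = true).
Proof. apply gen_sigma_base; now exists m. Qed.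

Lemma decode_point_borel : borel_fun cantor_sigma (borel_of_metric d) decode_point.
Proof.
  assert (HS : is_sigma cantor_sigma) by apply gen_sigma_is_sigma.
  assert (Hcoh : cantor_sigma coherent).
  { unfold coherent; apply sigma_and; [exact HS | |].
    - apply sigma_cinter; [exact HS|]; intros n.
      apply (sigma_cunion _ _ HS (fun i a => mem a n i)); intros i.
      apply cantor_sigma_coord.
    - do 4 (apply sigma_cinter; [exact HS|]; intro).
      repeat (apply sigma_imp; [exact HS | apply cantor_sigma_coord |]).
      now apply sigma_const. }
  apply borel_fun_gen; [exact HS|]; intros U HU.
  apply (sigma_ext _ cantor_sigma) with (A := fun a =>
    (coherent a /\
      exists n i, mem a n i /\ forall y, (d y (e i) <= rad n)%R -> U y) \/
    (~ coherent a /\ U (e 0))).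
  - apply sigma_or; [exact HS | |]; apply sigma_and; try exact HS.
    + exact Hcoh.
    + apply sigma_cunion; [exact HS|]; intros n.
      apply sigma_cunion; [exact HS|]; intros i.
      apply sigma_and; [exact HS | apply cantor_sigma_coord | now apply sigma_const].
    + now apply sigma_compl.
    + now apply sigma_const.
  - intros a; destruct (classic (coherent a)) as [Ha|Ha].
    + rewrite (decode_point_open U a HU Ha); tauto.
    + rewrite (proj2 (decode_point_spec a) Ha); tauto.
Qed.

End Retract.

(** * Analytic quasiorders reduce to normal trees *)

Lemma sbs_is_sigma (X : SBS) : is_sigma (sbs_meas X).
Proof.
  destruct (sbs_standard X) as (d & _ & H).
  rewrite (set_ext _ _ H); apply gen_sigma_is_sigma.
Qed.

Lemma borel_retract_of_cantor (X : SBS) : inhabited X ->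
  exists (code : X -> nat -> bool) (decode : (nat -> bool) -> X),
    borel_fun (sbs_meas X) cantor_sigma code /\
    borel_fun cantor_sigma (sbs_meas X) decode /\
    forall x, decode (code x) = x.
Proof.
  intros [x0]; destruct (sbs_standard X) as (d & (Hm & Hc & [[e He]|Hs]) & H).
  2: destruct (Hs x0).
  exists (code_point X d e), (decode_point X d e).
  rewrite (set_ext _ _ H); split; [|split].
  - now apply code_point_borel.
  - now apply decode_point_borel.
  - now apply decode_code_point.
Qed.

(** The Borel set behind [Rel] is pulled back along [decode]; over Cantor and Baire space its
    preimage is bisuslin, hence the projection of a closed set. *)
Lemma analytic_rel_cantor (X : SBS) (Rel : X -> X -> Prop)
  (decode : (nat -> bool) -> X) :
  analytic_rel X Rel -> borel_fun cantor_sigma (sbs_meas X) decode ->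
  exists Q, closed_rel _ agree_pair Q /\
    forall a b, Rel (decode a) (decode b) <-> exists g, Q (a, b) g.
Proof.
  intros (B & HB & HRel) Hdec.
  pose (Z := (((nat -> bool) * (nat -> bool)) * (nat -> nat))%type).
  pose (agr := fun n (z z' : Z) =>
    agree_pair n (fst z) (fst z') /\ agree n (snd z) (snd z')).
  assert (Hagr : forall m n z z', m <= n -> agr n z z' -> agr m z z').
  { intros m n z z' Hmn [H1 H2]; split;
      [now apply agree_pair_le with n | now apply agree_le with n]. }
  assert (HS := bisuslin_sigma Z agr Hagr).
  assert (Hcan : forall c : Z -> nat -> bool,
            (forall n z z', agr n z z' -> agree n (c z) (c z')) ->
            borel_fun (bisuslin Z agr) cantor_sigma c).
  { intros c Hc; apply borel_fun_gen; [exact HS|]; intros C [n ->].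
    apply bisuslin_clopen with (S n); intros z z' Hz.
    now rewrite (Hc _ _ _ Hz n ltac:(lia)). }
  assert (HB' : borel_fun (bisuslin Z agr)
            (prod_sigma (prod_sigma (sbs_meas X) (sbs_meas X)) baire_sigma)
            (fun z => (decode (fst (fst z)), decode (snd (fst z)), snd z))).
  { apply borel_fun_pair; [exact HS | apply borel_fun_pair; [exact HS | |] |].
    - apply (borel_fun_comp _ cantor_sigma); [apply Hcan | exact Hdec].
      intros n z z' Hz; apply Hz.
    - apply (borel_fun_comp _ cantor_sigma); [apply Hcan | exact Hdec].
      intros n z z' Hz; apply Hz.
    - apply borel_fun_gen; [exact HS|]; intros C (n & k & ->).
      apply bisuslin_clopen with (S n); intros z z' [_ Hz].
      now rewrite (Hz n ltac:(lia)). }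
  destruct (HB' B HB) as [(Q & Qc & HQ) _].
  (* The witness of analyticity and the Suslin witness are interleaved into one sequence, on even
     and odd places. *)
  exists (fun z g => Q (z, fun i => g (2 * i)) (fun i => g (2 * i + 1))); split.
  - intros z g Hz; destruct (Qc _ _ Hz) as [n Hn]; exists (2 * n).
    intros z' g' Hzz Hg; apply Hn.
    + split; simpl; [apply agree_pair_le with (2 := Hzz); lia|].
      intros i Hi; apply Hg; lia.
    + intros i Hi; apply Hg; lia.
  - intros a b.
    rewrite (HRel (decode a, decode b)); split.
    + intros [g Hg]; apply (HQ (a, b, g)) in Hg; destruct Hg as [h Hh].
      pose (k := fun i => if Nat.even i then g (Nat.div2 i) else h (Nat.div2 i)).
      assert (Hkg : (fun i => k (2 * i)) = g).
      { apply functional_extensionality; intros i; unfold k.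
        now rewrite Nat.even_even, Nat.div2_double. }
      assert (Hkh : (fun i => k (2 * i + 1)) = h).
      { apply functional_extensionality; intros i; unfold k.
        now rewrite Nat.even_odd, Nat.add_1_r, Nat.div2_succ_double. }
      exists k; rewrite Hkg, Hkh; exact Hh.
    + intros [g Hg]; exists (fun i => g (2 * i)).
      apply (HQ (a, b, fun i => g (2 * i))); eauto.
Qed.

(** The third clause provides a point separating [A_of (f x)] from [A_of (f y)] when [Rel x y]
    fails. The fourth concerns arbitrary common points, which need not be codes: each decodes to a
    common predecessor. *)
Lemma analytic_quasiorder_trees (X : SBS) (Rel : X -> X -> Prop) : C_qo X Rel ->
  exists f : X -> NTree,
    borel_fun (sbs_meas X) NTree_sigma f /\
    (forall x y, Rel x y -> le_S11 (f x) (f y)) /\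
    (forall x, exists a, forall y, A_of (f y) a <-> Rel x y) /\
    (forall x y a, A_of (f x) a -> A_of (f y) a -> exists z, Rel z x /\ Rel z y).
Proof.
  intros (Han & Hrefl & Htrans).
  destruct (classic (inhabited X)) as [HX|HX].
  (* An empty space is no retract of Cantor space; the empty map serves. *)
  2: { assert (Hempty : X -> False) by (intros x; apply HX; now constructor).
       exists (fun x => match Hempty x with end).
       repeat split; try (intros x; destruct (Hempty x)).
       intros B _; apply (sigma_ext _ _ (fun _ => True)); [apply sbs_is_sigma|].
       intros x; destruct (Hempty x). }
  destruct (borel_retract_of_cantor X HX) as (code & decode & Hcode & Hdec & Hcd).
  destruct (analytic_rel_cantor X Rel decode Han Hdec) as (Q & Qc & HQ).
  pose (R' := fun a b => Rel (decode a) (decode b)).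
  assert (Hr : forall a, R' a a) by (intros a; apply Hrefl).
  assert (Ht : forall a b c, R' a b -> R' b c -> R' a c)
    by (intros a b c; apply Htrans).
  assert (HA : forall x a, A_of (tree Q (code x)) a <-> Rel (decode a) x).
  { intros x a; rewrite (A_of_tree R' Q Hr Ht Qc HQ); unfold R'; now rewrite Hcd. }
  exists (fun x => tree Q (code x)); split; [|split; [|split]].
  - apply (borel_fun_comp _ cantor_sigma _ code (tree Q)); [exact Hcode|].
    assert (HS : is_sigma cantor_sigma) by apply gen_sigma_is_sigma.
    apply borel_fun_gen; [exact HS|]; intros C [l ->]; simpl.
    apply (sigma_finite_support cantor_sigma (fun a => a) Nat.odd (length l)
      (fun x => tree_fun Q x l = true)); [exact HS | exact bool_enum | |].
    + intros i v; apply (bool_coord_sigma cantor_sigma (fun x => x i));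
        [exact HS | apply cantor_sigma_coord].
    + apply tree_fun_local.
  - intros x y Hxy; apply (le_S11_tree R' Q Hr Ht Qc HQ).
    unfold R'; now rewrite !Hcd.
  - intros x; exists (code x); intros y; rewrite HA; now rewrite Hcd.
  - intros x y a Hx Hy; exists (decode a); split; now apply HA.
Qed.

(** * Cantor space and the relation of inclusion up to a shift *)

(** The usual ultrametric, [rad n] for a first difference at [n]; [epsilon] selects the value
    because equality of sequences is not decided by computation. *)
Definition cantor_dist (a b : nat -> bool) : R :=
  epsilon (inhabits 0%R) (fun r =>
    (a = b /\ r = 0%R) \/ exists n, agree n a b /\ a n <> b n /\ r = rad n).

Lemma first_difference {A : Type} (a b : nat -> A) :
  a <> b -> exists n, agree n a b /\ a n <> b n.
Proof.
  intros Hab; apply NNPP; intros Hno; apply Hab.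
  assert (H : forall n, agree n a b).
  { induction n as [|n IH]; [intros i Hi; lia|].
    intros i Hi; destruct (Nat.eq_dec i n) as [->|]; [|apply IH; lia].
    apply NNPP; intros Hn; apply Hno; eauto. }
  apply functional_extensionality; intros i; apply (H (S i)); lia.
Qed.

Lemma cantor_dist_spec a b :
  (a = b /\ cantor_dist a b = 0%R) \/
  exists n, agree n a b /\ a n <> b n /\ cantor_dist a b = rad n.
Proof.
  unfold cantor_dist; apply epsilon_spec.
  destruct (classic (a = b)) as [H|H]; [exists 0%R; tauto|].
  destruct (first_difference a b H) as (n & H1 & H2).
  exists (rad n); right; eauto.
Qed.

Lemma rad_lt m n : m < n -> (rad n < rad m)%R.
Proof.
  intros H; apply Rinv_0_lt_contravar; [apply lt_0_INR; lia | apply lt_INR; lia].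
Qed.

Lemma cantor_dist_le a b n : (cantor_dist a b <= rad n)%R <-> agree n a b.
Proof.
  destruct (cantor_dist_spec a b) as [[-> ->]|(m & H1 & H2 & ->)].
  - split; [intros _; apply agree_refl | intros _; apply Rlt_le, rad_pos].
  - destruct (le_lt_dec n m) as [H|H].
    + split; [intros _; now apply agree_le with m | intros _; now apply rad_le].
    + split; [|intros Hn; destruct (H2 (Hn m H))].
      intros Hr; assert (H3 := rad_lt _ _ H); lra.
Qed.

Lemma cantor_dist_cases a b :
  cantor_dist a b = 0%R \/ exists n, cantor_dist a b = rad n.
Proof. destruct (cantor_dist_spec a b) as [[_ H]|(n & _ & _ & H)]; eauto. Qed.

Lemma cantor_dist_nonneg a b : (0 <= cantor_dist a b)%R.
Proof.
  destruct (cantor_dist_cases a b) as [->|[n ->]]; [lra | apply Rlt_le, rad_pos].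
Qed.

Lemma cantor_dist_le_of_agree a b c d :
  (forall n, agree n c d -> agree n a b) -> (cantor_dist a b <= cantor_dist c d)%R.
Proof.
  intros H; destruct (cantor_dist_cases c d) as [H0|[n Hn]].
  - rewrite H0; apply Rle_rad_eps; intros n.
    assert (H1 : (cantor_dist a b <= rad n)%R); [|assert (H2 := rad_pos n); lra].
    apply cantor_dist_le, H, cantor_dist_le; rewrite H0; apply Rlt_le, rad_pos.
  - rewrite Hn; apply cantor_dist_le, H, cantor_dist_le; rewrite Hn; lra.
Qed.

Lemma cantor_dist_metric : is_metric cantor_dist.
Proof.
  split; [exact cantor_dist_nonneg|]; split; [|split].
  - intros a b; split.
    + intros H; apply functional_extensionality; intros i.
      apply (proj1 (cantor_dist_le a b (S i))); [|lia].
      rewrite H; apply Rlt_le, rad_pos.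
    + intros <-; destruct (cantor_dist_spec a a) as [[_ H]|(n & _ & H & _)];
        [exact H | now destruct H].
  - intros a b; apply Rle_antisym; apply cantor_dist_le_of_agree; intros n;
      apply agree_sym.
  - intros a b c.
    assert (Hb := cantor_dist_nonneg a b); assert (Hc := cantor_dist_nonneg b c).
    destruct (Rle_dec (cantor_dist a b) (cantor_dist b c)) as [H|H].
    + enough (cantor_dist a c <= cantor_dist b c)%R by lra.
      apply cantor_dist_le_of_agree; intros n Hn; apply agree_trans with b; [|exact Hn].
      apply cantor_dist_le; apply cantor_dist_le in Hn; lra.
    + enough (cantor_dist a c <= cantor_dist a b)%R by lra.
      apply cantor_dist_le_of_agree; intros n Hn; apply agree_trans with b; [exact Hn|].
      apply cantor_dist_le; apply cantor_dist_le in Hn; lra.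
Qed.

Lemma cantor_dist_complete : metric_complete cantor_dist.
Proof.
  intros u Hu.
  assert (HN : forall n, exists N, forall m k, N <= m -> N <= k -> agree n (u m) (u k)).
  { intros n; destruct (Hu (rad n) (rad_pos n)) as [N HN].
    exists N; intros m k Hm Hk; apply cantor_dist_le, Rlt_le; auto. }
  destruct (choice _ HN) as [N HN'].
  (* Bit [i] is read off at a stage from which the first [S i] bits are constant. *)
  exists (fun i => u (N (S i)) i); intros eps Heps.
  destruct (rad_small eps Heps) as [n Hn]; exists (N n); intros m Hm.
  apply Rle_lt_trans with (2 := Hn), cantor_dist_le; intros i Hi.
  (* A term late enough for both stages connects the two. *)
  transitivity (u (m + N (S i)) i).
  - apply (HN' n); lia.
  - apply (HN' (S i)); lia.
Qed.

(** * Coding of nodes by numbers and a dense sequence in Cantor space *)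

Fixpoint node_code (l : node) : nat :=
  match l with
  | [] => 0
  | (b, n) :: l => S (to_nat (Nat.b2n b, to_nat (n, node_code l)))
  end.

Lemma node_code_inj l l' : node_code l = node_code l' -> l = l'.
Proof.
  revert l'; induction l as [|[b n] l IH]; intros [|[b' n'] l'];
    cbn [node_code]; intros H; try discriminate; [reflexivity|].
  apply Nat.succ_inj, to_nat_inj, pair_equal_spec in H; destruct H as [Hb H].
  apply to_nat_inj, pair_equal_spec in H; destruct H as [Hn H].
  rewrite (IH l' H), Hn; f_equal; f_equal.
  now destruct b, b'.
Qed.

(** A left inverse of the code; numbers that code nothing decode to an unspecified node. *)
Definition node_decode (k : nat) : node :=
  epsilon (inhabits []) (fun l => node_code l = k).

Lemma node_decode_code l : node_decode (node_code l) = l.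
Proof.
  apply node_code_inj; unfold node_decode; apply epsilon_spec; now exists l.
Qed.

Lemma node_enum l : exists k, node_decode k = l.
Proof. exists (node_code l); apply node_decode_code. Qed.

Definition cantor_enum (k : nat) : nat -> bool := node_u (node_decode k).

Lemma cantor_enum_dense a n : exists k, agree n a (cantor_enum k).
Proof.
  exists (node_code (prefix a (fun _ => 0) n)); unfold cantor_enum.
  rewrite node_decode_code; apply agree_sym, node_prefix.
Qed.

Lemma cantor_dist_separable : metric_separable cantor_dist.
Proof.
  left; exists cantor_enum; intros a eps Heps.
  destruct (rad_small eps Heps) as [n Hn].
  destruct (cantor_enum_dense a n) as [k Hk]; exists k.
  apply Rle_lt_trans with (2 := Hn); now apply cantor_dist_le.
Qed.

Definition cantor_sbs : SBS.
Proof.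
  refine {| sbs_carrier := nat -> bool; sbs_meas := borel_of_metric cantor_dist |}.
  exists cantor_dist; split; [|reflexivity].
  split; [exact cantor_dist_metric | split];
    [exact cantor_dist_complete | exact cantor_dist_separable].
Defined.

(** An open set is a countable union of basic clopen sets around the points [cantor_enum k], each a
    condition on finitely many bits. *)
Lemma borel_fun_cantor_sbs {X : Type} (mX : set (set X)) (f : X -> cantor_sbs) :
  is_sigma mX -> (forall n, mX (fun x => f x n = true)) ->
  borel_fun mX (sbs_meas cantor_sbs) f.
Proof.
  intros HX Hf; apply borel_fun_gen; [exact HX|]; intros U HU.
  apply (sigma_ext _ mX) with (A := fun x => exists n k,
    (forall b, agree n b (cantor_enum k) -> U b) /\ agree n (f x) (cantor_enum k)).
  - apply sigma_cunion; [exact HX|]; intros n.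
    apply sigma_cunion; [exact HX|]; intros k.
    apply sigma_and; [exact HX | now apply sigma_const |].
    unfold agree; apply sigma_cinter; [exact HX|]; intros i.
    apply sigma_imp; [exact HX | now apply sigma_const |].
    now apply (bool_coord_sigma mX (fun x => f x i)).
  - intros x; split.
    + intros (n & k & H1 & H2); now apply H1.
    + intros H; destruct (HU _ H) as (r & Hr & HUr).
      destruct (rad_small r Hr) as [n Hn].
      destruct (cantor_enum_dense (f x) n) as [k Hk]; exists n, k; split; [|exact Hk].
      intros b Hb; apply HUr, Rle_lt_trans with (2 := Hn), cantor_dist_le.
      apply agree_trans with (1 := Hk); now apply agree_sym.
Qed.

Lemma cantor_sbs_coord n : sbs_meas cantor_sbs (fun a => a n = true).
Proof.
  apply gen_sigma_base; intros a Ha; exists (rad (S n)); split; [apply rad_pos|].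
  intros b Hb; rewrite <- Ha; symmetry.
  apply (proj1 (cantor_dist_le a b (S n))); [apply Rlt_le, Hb | lia].
Qed.

(** * Shifts of nodes, and inclusion up to a shift for arbitrary sets of nodes *)

Definition shift (l : node) (al : nat -> nat) : node :=
  combine (map fst l)
    (map (fun i => nth i (map snd l) 0 + al i) (seq 0 (length l))).

Lemma shift_length l al : length (shift l al) = length l.
Proof. apply length_combine_fst; now rewrite length_map, length_seq. Qed.

Lemma shift_nth l al i : i < length l ->
  node_u (shift l al) i = node_u l i /\ node_s (shift l al) i = node_s l i + al i.
Proof.
  intros Hi.
  destruct (node_combine l
    (map (fun i => nth i (map snd l) 0 + al i) (seq 0 (length l))) i) as [H1 H2];
    [now rewrite length_map, length_seq|].
  split; [exact H1|]; unfold shift; rewrite H2, nth_map_seq by exact Hi.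
  now rewrite nth_map_snd.
Qed.

Lemma node_ext (l l' : node) : length l = length l' ->
  agree (length l) (node_u l) (node_u l') ->
  agree (length l) (node_s l) (node_s l') -> l = l'.
Proof.
  intros Hl Hu Hs; apply nth_ext with (false, 0) (false, 0); [exact Hl|].
  intros i Hi; specialize (Hu i Hi); specialize (Hs i Hi); revert Hu Hs.
  unfold node_u, node_s; destruct (nth i l _), (nth i l' _); simpl; congruence.
Qed.

Lemma shift_zero l : shift l (fun _ => 0) = l.
Proof.
  apply node_ext; rewrite shift_length; [reflexivity | |]; intros i Hi;
    destruct (shift_nth l (fun _ => 0) i Hi); lia || assumption.
Qed.

Lemma shift_shift l al be : shift (shift l al) be = shift l (fun i => al i + be i).
Proof.
  apply node_ext; rewrite !shift_length; [reflexivity | |]; intros i Hi;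
    destruct (shift_nth l al i Hi) as [H1 H2],
      (shift_nth l (fun i => al i + be i) i Hi) as [H3 H4],
      (shift_nth (shift l al) be i) as [H5 H6]; try (rewrite shift_length; exact Hi).
  - congruence.
  - lia.
Qed.

Lemma shift_local l al be : agree (length l) al be -> shift l al = shift l be.
Proof.
  intros H; unfold shift; f_equal; apply map_ext_in; intros i Hi.
  apply in_seq in Hi; rewrite H by lia; reflexivity.
Qed.

(** The body of [le_S11], extended from normal trees to all sets of nodes given by characteristic
    functions on codes, so that the relation lives on Cantor space. *)
Definition shift_incl (x y : nat -> bool) (al : nat -> nat) : Prop :=
  forall l, x (node_code l) = true -> y (node_code (shift l al)) = true.

Definition cantor_le (x y : nat -> bool) : Prop := exists al, shift_incl x y al.

Lemma shift_incl_zero x : shift_incl x x (fun _ => 0).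
Proof. intros l; now rewrite shift_zero. Qed.

Lemma cantor_le_trans x y z : cantor_le x y -> cantor_le y z -> cantor_le x z.
Proof.
  intros [al Hal] [be Hbe]; exists (fun i => al i + be i); intros l Hl.
  rewrite <- shift_shift; auto.
Qed.

Lemma shift_incl_sigma {Z : Type} (S : set (set Z)) (x y : Z -> nat -> bool)
  (al : Z -> nat -> nat) :
  is_sigma S -> (forall n, S (fun z => x z n = true)) ->
  (forall n, S (fun z => y z n = true)) -> (forall n k, S (fun z => al z n = k)) ->
  S (fun z => shift_incl (x z) (y z) (al z)).
Proof.
  intros HS Hx Hy Hal.
  (* Naming the code [m] of the shifted node lets [y z] be read at a fixed index; that the code is
     [m] depends on finitely many values of [al z]. *)
  apply (sigma_ext _ S) with (A := fun z => forall k,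
    x z (node_code (node_decode k)) = true ->
    exists m, node_code (shift (node_decode k) (al z)) = m /\ y z m = true).
  - apply sigma_cinter; [exact HS|]; intros k.
    apply sigma_imp; [exact HS | apply Hx|].
    apply sigma_cunion; [exact HS|]; intros m.
    apply sigma_and; [exact HS | | apply Hy].
    apply (sigma_finite_support S al (fun k => k) (length (node_decode k))
      (fun al => node_code (shift (node_decode k) al) = m)); [exact HS | eauto | apply Hal |].
    intros a b Hab; now rewrite (shift_local _ a b Hab).
  - intros z; split.
    + intros H l Hl; destruct (node_enum l) as [k <-].
      now destruct (H k Hl) as (m & <- & Hm).
    + intros H k Hk; eauto.
Qed.

Lemma cantor_triple_sigma (S : set (set ((cantor_sbs * cantor_sbs) * (nat -> nat)))) :
  S = prod_sigma (prod_sigma (sbs_meas cantor_sbs) (sbs_meas cantor_sbs)) baire_sigma ->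
  is_sigma S /\ (forall n, S (fun z => fst (fst z) n = true)) /\
  (forall n, S (fun z => snd (fst z) n = true)) /\
  (forall n k, S (fun z => snd z n = k)).
Proof.
  intros ->.
  assert (HC := sbs_is_sigma cantor_sbs).
  assert (HB : is_sigma baire_sigma) by apply gen_sigma_is_sigma.
  assert (HCC : is_sigma (prod_sigma (sbs_meas cantor_sbs) (sbs_meas cantor_sbs)))
    by apply gen_sigma_is_sigma.
  split; [apply gen_sigma_is_sigma | split; [|split]].
  - intros n.
    apply (borel_fun_fst _ _ HB (fun p => fst p n = true)).
    apply (borel_fun_fst _ _ HC (fun a : cantor_sbs => a n = true)), cantor_sbs_coord.
  - intros n.
    apply (borel_fun_fst _ _ HB (fun p => snd p n = true)).
    apply (borel_fun_snd _ _ HC (fun a : cantor_sbs => a n = true)), cantor_sbs_coord.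
  - intros n k; apply (borel_fun_snd _ _ HCC (fun b => b n = k)).
    apply gen_sigma_base; eauto.
Qed.

Lemma cantor_le_qo : C_qo cantor_sbs cantor_le.
Proof.
  split; [|split].
  - exists (fun z => shift_incl (fst (fst z)) (snd (fst z)) (snd z)); split.
    + destruct (cantor_triple_sigma _ eq_refl) as (H1 & H2 & H3 & H4).
      now apply (shift_incl_sigma _ (fun z => fst (fst z)) (fun z => snd (fst z)) snd).
    + intros y; reflexivity.
  - intros x; eexists; apply shift_incl_zero.
  - intros x y z; apply cantor_le_trans.
Qed.

Definition cantor_equiv (x y : nat -> bool) : Prop := cantor_le x y /\ cantor_le y x.

Lemma cantor_equiv_eq : C_eq cantor_sbs cantor_equiv.
Proof.
  split; [|split; [|split]].
  (* One sequence holds the shifts for both directions, paired value by value. *)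
  - exists (fun z =>
      shift_incl (fst (fst z)) (snd (fst z)) (fun i => fst (of_nat (snd z i))) /\
      shift_incl (snd (fst z)) (fst (fst z)) (fun i => snd (of_nat (snd z i)))).
    split.
    + destruct (cantor_triple_sigma _ eq_refl) as (H1 & H2 & H3 & H4).
      assert (H5 : forall (h : nat -> nat) n k,
        prod_sigma (prod_sigma (sbs_meas cantor_sbs) (sbs_meas cantor_sbs)) baire_sigma
          (fun z => h (snd z n) = k)).
      { intros h n k.
        apply (sigma_ext _ _ (fun z => exists j, snd z n = j /\ h j = k)).
        - apply sigma_cunion; [exact H1|]; intros j.
          apply sigma_and; [exact H1 | apply H4 | now apply sigma_const].
        - intros z; split; [intros (j & <- & Hj); exact Hj | eauto]. }
      apply sigma_and; [exact H1 | |].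
      * apply (shift_incl_sigma _ (fun z => fst (fst z)) (fun z => snd (fst z))
          (fun z i => fst (of_nat (snd z i)))); try assumption.
        exact (H5 (fun j => fst (of_nat j))).
      * apply (shift_incl_sigma _ (fun z => snd (fst z)) (fun z => fst (fst z))
          (fun z i => snd (of_nat (snd z i)))); try assumption.
        exact (H5 (fun j => snd (of_nat j))).
    + intros [x y]; simpl; split.
      * intros [[al Hal] [be Hbe]]; exists (fun i => to_nat (al i, be i)).
        split; intros l Hl; [specialize (Hal l Hl) | specialize (Hbe l Hl)].
        -- erewrite shift_local; [exact Hal|].
           intros i _; now rewrite cancel_of_to.
        -- erewrite shift_local; [exact Hbe|].
           intros i _; now rewrite cancel_of_to.
      * intros [g [H1 H2]]; split; eexists; eassumption.
  - intros x; split; eexists; apply shift_incl_zero.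
  - intros x y [H1 H2]; now split.
  - intros x y z [H1 H2] [H3 H4]; split; eapply cantor_le_trans; eassumption.
Qed.

(** * Normal trees as points of Cantor space, and the completeness theorem *)

Definition tree_char (T : NTree) : cantor_sbs := fun k => proj1_sig T (node_decode k).

Lemma tree_char_borel : borel_fun NTree_sigma (sbs_meas cantor_sbs) tree_char.
Proof.
  apply borel_fun_cantor_sbs; [apply gen_sigma_is_sigma|].
  intros n; apply gen_sigma_base; now exists (node_decode n).
Qed.

Lemma tree_char_le S T : cantor_le (tree_char S) (tree_char T) <-> le_S11 S T.
Proof.
  unfold cantor_le, shift_incl, tree_char; split; intros [al H]; exists al; intros l Hl.
  - specialize (H l); rewrite !node_decode_code in H; exact (H Hl).
  - rewrite node_decode_code in *; exact (H l Hl).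
Qed.

(** A branch [b] of [S] over [a] becomes the branch [b + al] of [T] over the same [a], as prefixes
    commute with shifts. *)
Lemma le_S11_A_of S T a : le_S11 S T -> A_of S a -> A_of T a.
Proof.
  intros [al H] [b Hb]; exists (fun i => b i + al i); intros n.
  specialize (H _ (Hb n)); fold (shift (prefix a b n) al) in H.
  replace (prefix a _ n) with (shift (prefix a b n) al); [exact H|].
  destruct (node_prefix a b n) as (H1 & H2 & H3),
    (node_prefix a (fun i => b i + al i) n) as (H4 & H5 & H6).
  apply node_ext; rewrite shift_length, H1; [now rewrite H4 | |]; intros i Hi;
    destruct (shift_nth (prefix a b n) al i) as [H7 H8]; try (now rewrite H1).
  - now rewrite H7, H2, H5.
  - now rewrite H8, H3, H6.
Qed.

Lemma C_eq_qo (X : SBS) (Rel : X -> X -> Prop) : C_eq X Rel -> C_qo X Rel.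
Proof. intros (H1 & H2 & H3 & H4); now repeat split. Qed.

Theorem mainTheorem1 :
  complete_for C_qo NTree_sigma le_S11 notsub_S11 /\
  complete_for C_eq NTree_sigma equiv_S11 disj_S11 /\
  complete_for C_eq NTree_sigma equiv_S11 neq_S11.
Proof.
  assert (Hequiv : forall S T, equiv_S11 S T -> forall a, A_of S a <-> A_of T a)
    by (intros S T [H1 H2] a; split; now apply le_S11_A_of).
  assert (Hchar : forall S T,
            cantor_equiv (tree_char S) (tree_char T) <-> equiv_S11 S T)
    by (intros S T; unfold cantor_equiv; now rewrite !tree_char_le).
  split; [|split]; split.
  - intros X Rel HR.
    destruct (analytic_quasiorder_trees X Rel HR) as (f & Hf & Hle & Hpt & _).
    exists f; split; [exact Hf | split; [exact Hle|]].
    (* The point [a] belonging to [x] lies in [A_of (f x)] by reflexivity; inclusion would put it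
       into [A_of (f y)] and yield [Rel x y]. *)
    intros x y Hxy Hsub; destruct (Hpt x) as [a Ha]; apply Hxy, Ha, Hsub, Ha, HR.
  - exists cantor_sbs, cantor_le; split; [exact cantor_le_qo|].
    exists tree_char; split; [exact tree_char_borel | split].
    + intros S T; apply tree_char_le.
    + intros S T HST H; apply HST; intros a.
      now apply le_S11_A_of, tree_char_le.
  - intros X Rel HR.
    destruct (analytic_quasiorder_trees X Rel (C_eq_qo X Rel HR))
      as (f & Hf & Hle & Hpt & Hdisj).
    destruct HR as (_ & Hr & Hs & Ht).
    exists f; split; [exact Hf | split].
    + intros x y Hxy; split; auto.
    + assert (Hne : forall x, exists a, A_of (f x) a)
        by (intros x; destruct (Hpt x) as [a Ha]; exists a; now apply Ha).
      intros x y Hxy; split; [apply Hne | split; [apply Hne|]].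
      (* A common point yields [z] equivalent to both [x] and [y], which would make these
         equivalent. *)
      intros a [Hx Hy]; destruct (Hdisj x y a Hx Hy) as (z & Hzx & Hzy).
      apply Hxy, Ht with z; auto.
  - exists cantor_sbs, cantor_equiv; split; [exact cantor_equiv_eq|].
    exists tree_char; split; [exact tree_char_borel | split].
    + intros S T; apply Hchar.
    (* Equivalent trees have equal projections, and a nonempty set is not disjoint from itself. *)
    + intros S T ([a Ha] & _ & HST) H; apply Hchar in H.
      apply (HST a); split; [exact Ha | now apply (Hequiv S T H)].
  - intros X Rel HR.
    destruct (analytic_quasiorder_trees X Rel (C_eq_qo X Rel HR))
      as (f & Hf & Hle & Hpt & _).
    destruct HR as (_ & Hr & Hs & Ht).
    exists f; split; [exact Hf | split].
    + intros x y Hxy; split; auto.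
    + intros x y Hxy H; destruct (Hpt x) as [a Ha].
      apply Hxy, Ha, H, Ha, Hr.
  - exists cantor_sbs, cantor_equiv; split; [exact cantor_equiv_eq|].
    exists tree_char; split; [exact tree_char_borel | split].
    + intros S T; apply Hchar.
    + intros S T HST H; apply HST, Hequiv, Hchar, H.
Qed.
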